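(* There does not exist a factorable surface of second kind in the pseudo-Galilean space $\mathbb{G}_3^1$ having non-zero constant Gaussian curvature. That is, there are no smooth real-valued functions $f$ and $g$ of one real variable, each defined on an open interval, such that the surface $x(y,z)=f(y)g(z)$ is admissible and non-lightlike and its Gaussian curvature is identically equal to a non-zero constant.
   Context: The pseudo-Galilean space $\mathbb{G}_3^1$ is considered in its affine model with coordinates $(x,y,z)\in\mathbb{R}^3$. For vectors with zero first component, the Minkowskian scalar product is $(0,a,b)\cdot(0,c,d)=ac-bd$. Let a surface be given by a smooth immersion $r(u_1,u_2)=(x(u_1,u_2),y(u_1,u_2),z(u_1,u_2))$ on a domain of $\mathbb{R}^2$. Write $x_{,i}=\partial x/\partial u_i$, $x_{,ij}=\partial^2x/\partial u_i\partial u_j$, and similarly for $y,z,r$. Put $\mathfrak{g}_i=x_{,i}$ and $\mathfrak{g}_{i,j}=\partial\mathfrak{g}_i/\partial u_j=x_{,ij}$. The surface is admissible if at each point $x_{,i}\neq0$ for some $i\in\{1,2\}$. Put $$W=\sqrt{\left|(x_{,1}y_{,2}-x_{,2}y_{,1})^2-(x_{,1}z_{,2}-x_{,2}z_{,1})^2\right|}.$$ The surface is lightlike if $W=0$; throughout, all surfaces are assumed admissible and non-lightlike ($W\neq0$ everywhere). Set $$S=\frac1W\left(0,\;x_{,1}y_{,2}-x_{,2}y_{,1},\;x_{,1}z_{,2}-x_{,2}z_{,1}\right),\qquad \varepsilon=S\cdot S\in\{-1,1\}.$$ The normal vector field is $$N=\frac1W\left(0,\;x_{,1}z_{,2}-x_{,2}z_{,1},\;x_{,1}y_{,2}-x_{,2}y_{,1}\right).$$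 The coefficients of the second fundamental form are $$L_{ij}=\frac{\varepsilon}{\mathfrak{g}_1}\left(\mathfrak{g}_1(0,y_{,ij},z_{,ij})-\mathfrak{g}_{i,j}(0,y_{,1},z_{,1})\right)\cdot N\quad\text{if }\mathfrak{g}_1\neq0,$$ and otherwise $$L_{ij}=\frac{\varepsilon}{\mathfrak{g}_2}\left(\mathfrak{g}_2(0,y_{,ij},z_{,ij})-\mathfrak{g}_{i,j}(0,y_{,2},z_{,2})\right)\cdot N.$$ The Gaussian curvature is $$K=-\varepsilon\,\frac{L_{11}L_{22}-L_{12}^2}{W^2}.$$ A factorable surface of second kind is the graph $x(y,z)=f(y)g(z)$, parametrized by $r(y,z)=(f(y)g(z),y,z)$ with $(u_1,u_2)=(y,z)$. *)

(* Defs.v *)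
From Stdlib Require Import Reals.
From Coquelicot Require Import Coquelicot.

Open Scope R_scope.

(** A parametrized surface [r = (x, y, z)] of the affine model of the
    pseudo-Galilean space.  The coordinates are total functions; only their
    values on the (open) parameter domain matter. *)
Record surface := Surface {
  cx : R -> R -> R;
  cy : R -> R -> R;
  cz : R -> R -> R
}.

Inductive index := i1 | i2.

Definition pd (i : index) (h : R -> R -> R) : R -> R -> R := fun u1 u2 =>
  match i with
  | i1 => Derive (fun t => h t u2) u1
  | i2 => Derive (fun t => h u1 t) u2
  end.

(** [pd2 i j h] is [h_{,ij}], read as the derivative in [u_j] of [h_{,i}];
    the order is immaterial for smooth [h]. *)
Definition pd2 (i j : index) (h : R -> R -> R) : R -> R -> R := pd j (pd i h).

(** Minkowskian scalar product of two isotropic vectors.  The product is only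
    meaningful, and only used below, when both first components vanish. *)
Definition mdot (v w : R * R * R) : R :=
  snd (fst v) * snd (fst w) - snd v * snd w.

Definition gi (r : surface) (i : index) : R -> R -> R := pd i (cx r).
Definition gij (r : surface) (i j : index) : R -> R -> R := pd j (gi r i).

Definition admissible (D : R -> R -> Prop) (r : surface) : Prop :=
  forall u1 u2, D u1 u2 -> exists i : index, pd i (cx r) u1 u2 <> 0.

Definition minor_xy (r : surface) (u1 u2 : R) : R :=
  pd i1 (cx r) u1 u2 * pd i2 (cy r) u1 u2
  - pd i2 (cx r) u1 u2 * pd i1 (cy r) u1 u2.

Definition minor_xz (r : surface) (u1 u2 : R) : R :=
  pd i1 (cx r) u1 u2 * pd i2 (cz r) u1 u2
  - pd i2 (cx r) u1 u2 * pd i1 (cz r) u1 u2.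

Definition W (r : surface) (u1 u2 : R) : R :=
  sqrt (Rabs (minor_xy r u1 u2 ^ 2 - minor_xz r u1 u2 ^ 2)).

Definition non_lightlike (D : R -> R -> Prop) (r : surface) : Prop :=
  forall u1 u2, D u1 u2 -> W r u1 u2 <> 0.

Definition side_tangent (r : surface) (u1 u2 : R) : R * R * R :=
  scal (/ W r u1 u2) (0, minor_xy r u1 u2, minor_xz r u1 u2).

Definition eps (r : surface) (u1 u2 : R) : R :=
  mdot (side_tangent r u1 u2) (side_tangent r u1 u2).

Definition normal (r : surface) (u1 u2 : R) : R * R * R :=
  scal (/ W r u1 u2) (0, minor_xz r u1 u2, minor_xy r u1 u2).

(** The expression for [L_{ij}] built on the parameter [u_k]; it is used when
    [gi r k] does not vanish. *)
Definition L_via (k : index) (r : surface) (i j : index) (u1 u2 : R) : R :=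
  eps r u1 u2 / gi r k u1 u2 *
  mdot
    (minus
       (scal (gi r k u1 u2) (0, pd2 i j (cy r) u1 u2, pd2 i j (cz r) u1 u2))
       (scal (gij r i j u1 u2) (0, pd k (cy r) u1 u2, pd k (cz r) u1 u2)))
    (normal r u1 u2).

Definition L (r : surface) (i j : index) (u1 u2 : R) : R :=
  if Req_EM_T (gi r i1 u1 u2) 0 then L_via i2 r i j u1 u2
  else L_via i1 r i j u1 u2.

Definition gauss_curvature (r : surface) (u1 u2 : R) : R :=
  - eps r u1 u2 *
  ((L r i1 i1 u1 u2 * L r i2 i2 u1 u2 - L r i1 i2 u1 u2 ^ 2) / W r u1 u2 ^ 2).

(** The graph [x = f(y) g(z)] with parameters [(u1, u2) = (y, z)]. *)
Definition factorable2 (f g : R -> R) : surface :=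
  Surface (fun y z => f y * g z) (fun y _ => y) (fun _ z => z).

Definition in_open (a b : Rbar) (t : R) : Prop := Rbar_lt a t /\ Rbar_lt t b.

Definition smooth_on (a b : Rbar) (f : R -> R) : Prop :=
  forall (n : nat) (t : R), in_open a b t -> ex_derive_n f n t.

Definition rect (a b c d : Rbar) (y z : R) : Prop :=
  in_open a b y /\ in_open c d z.

(* Main.v *)
Require Import Defs.
From Stdlib Require Import Reals Ranalysis5 Lra Classical.
From Coquelicot Require Import Coquelicot.

(** Put [D = (f g')^2 - (f' g)^2]; non-lightlike means [D <> 0].  All second
    derivatives of the coordinates [y] and [z] vanish, so [L_ij] is
    [- eps x_ij / W] whichever parameter is used to define it, and with
    [W^2 = |D|], [eps = D / |D|] constant curvature [K] becomes the
    Monge-Ampere equation [f f'' g g'' - f'^2 g'^2 = - K |D| D].  The sign of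
    [D] is constant on the rectangle ([causal_sign_constant]), so the right-hand
    side is [C D^2] with a non-zero constant [C] ([constant_curvature_monge]).

    The equation is then excluded for any smooth [f] and [g] with [D <> 0]
    ([no_monge_solution]).  After shrinking the rectangle, [f] and [g] do not
    vanish.  Let [P = (f'/f)^2] and [Q = (g'/g)^2], so that
    [D = f^2 g^2 (Q - P)].  Evaluated at three values of [y] and three of [z],
    the left-hand side is a 3 x 3 matrix that is a combination of two products
    (function of y) x (function of z), so its determinant is zero.  On the
    right, [(Q_j - P_i)^2] has determinant twice the product of the Vandermonde
    determinants of the [P_i] and of the [Q_j].  Hence one of [P], [Q] takes at
    most two values ([monge_at_most_two_values]) and, being continuous, is
    constant.  The equation being symmetric in [f] and [g], let [P] be constant.
    Then [f] is an exponential or a constant, the left-hand side is a multiple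
    of [f^2] for fixed [z] while the right-hand side is a non-zero multiple of
    [f^4]; so [f] is constant, the left-hand side is zero, and [D = 0], a
    contradiction ([no_constant_log_slope_sqr]). *)

(** * Calculus on open intervals *)

Lemma in_open_between (a b : Rbar) (s t u : R) :
  in_open a b s -> in_open a b u -> s <= t <= u -> in_open a b t.
Proof.
intros [Hs _] [_ Hu] [H1 H2]; split.
- apply Rbar_lt_le_trans with (Finite s); [exact Hs | exact H1].
- apply Rbar_le_lt_trans with (Finite u); [exact H2 | exact Hu].
Qed.

Lemma in_open_locally (a b : Rbar) (t : R) :
  in_open a b t -> locally t (in_open a b).
Proof.
intros [H1 H2]; apply filter_and.
- exact (open_Rbar_gt' (Finite t) a H1).
- exact (open_Rbar_lt' (Finite t) b H2).
Qed.

Lemma in_open_inhabited (a b : Rbar) :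
  Rbar_lt a b -> exists t : R, in_open a b t.
Proof.
unfold in_open; destruct a as [a| |]; destruct b as [b| |]; simpl; intros H;
  try easy.
- exists ((a + b) / 2); lra.
- exists (a + 1); lra.
- exists (b - 1); lra.
- now exists 0.
Qed.

Lemma smooth_on_is_derive (a b : Rbar) (f : R -> R) (t : R) :
  smooth_on a b f -> in_open a b t -> is_derive f t (Derive f t).
Proof. intros Hf Ht; apply Derive_correct; exact (Hf 1%nat t Ht). Qed.

Lemma smooth_on_is_derive2 (a b : Rbar) (f : R -> R) (t : R) :
  smooth_on a b f -> in_open a b t ->
  is_derive (Derive f) t (Derive (Derive f) t).
Proof. intros Hf Ht; apply Derive_correct; exact (Hf 2%nat t Ht). Qed.

Lemma is_derive_sqr (h : R -> R) (t l : R) :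
  is_derive h t l -> is_derive (fun s => h s ^ 2) t (2 * h t * l).
Proof.
intros H; replace (2 * h t * l) with (INR 2 * l * h t ^ pred 2)
  by (simpl; ring).
now apply is_derive_pow.
Qed.

Lemma is_derive_unique_on (a b : Rbar) (h1 h2 : R -> R) (t l1 l2 : R) :
  (forall s, in_open a b s -> h1 s = h2 s) -> in_open a b t ->
  is_derive h1 t l1 -> is_derive h2 t l2 -> l1 = l2.
Proof.
intros E Ht D1 D2.
rewrite <- (is_derive_unique _ _ _ D1), <- (is_derive_unique _ _ _ D2).
apply Derive_ext_loc.
apply filter_imp with (2 := in_open_locally a b t Ht); exact E.
Qed.

Lemma IVT_in_open (a b : Rbar) (h : R -> R) (s t v : R) :
  (forall u, in_open a b u -> ex_derive h u) ->
  in_open a b s -> in_open a b t -> h s < v < h t ->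
  exists u, in_open a b u /\ h u = v.
Proof.
intros Hd Hs Ht Hv.
assert (Hc : forall u, in_open a b u -> continuity_pt h u).
{ intros u Hu; apply continuity_pt_filterlim.
  now apply (ex_derive_continuous (V := R_NormedModule)), Hd. }
destruct (Rtotal_order s t) as [Hst | [-> | Hst]].
- destruct (IVT_interv (fun u => h u - v) s t) as [u [Hu Eu]]; try lra.
  + intros u Hu; apply continuity_pt_minus.
    * apply Hc; now apply in_open_between with s t.
    * apply continuity_pt_const; now intros ? ?.
  + exists u; split; [now apply in_open_between with s t | lra].
- lra.
- destruct (IVT_interv (fun u => v - h u) t s) as [u [Hu Eu]]; try lra.
  + intros u Hu; apply continuity_pt_minus.
    * apply continuity_pt_const; now intros ? ?.
    * apply Hc; now apply in_open_between with t s.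
  + exists u; split; [now apply in_open_between with t s | lra].
Qed.

Lemma nonvanishing_same_sign (a b : Rbar) (h : R -> R) (s t : R) :
  (forall u, in_open a b u -> ex_derive h u) ->
  (forall u, in_open a b u -> h u <> 0) ->
  in_open a b s -> in_open a b t -> 0 < h s -> 0 < h t.
Proof.
intros Hd Hn Hs Ht Ps.
destruct (Rlt_or_le 0 (h t)) as [P | P]; [exact P | exfalso].
pose proof (Hn t Ht) as Nt.
destruct (IVT_in_open a b h t s 0) as [u [Hu Eu]]; auto; [lra |].
exact (Hn u Hu Eu).
Qed.

(** Phrased on triples of points because this is the form in which a vanishing
    Vandermonde product delivers it. *)
Definition takes_at_most_two_values (a b : Rbar) (h : R -> R) : Prop :=
  forall t1 t2 t3, in_open a b t1 -> in_open a b t2 -> in_open a b t3 ->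
    h t1 = h t2 \/ h t1 = h t3 \/ h t2 = h t3.

(** A third value, the mean of two distinct ones, would be attained. *)
Lemma at_most_two_values_constant (a b : Rbar) (h : R -> R) :
  (forall u, in_open a b u -> ex_derive h u) -> takes_at_most_two_values a b h ->
  forall s t, in_open a b s -> in_open a b t -> h s = h t.
Proof.
intros Hd H3.
assert (H : forall s t, in_open a b s -> in_open a b t -> ~ h s < h t).
{ intros s t Hs Ht Hst.
  destruct (IVT_in_open a b h s t ((h s + h t) / 2)) as [u [Hu Eu]]; auto.
  - lra.
  - destruct (H3 s t u Hs Ht Hu) as [E | [E | E]]; lra. }
intros s t Hs Ht.
pose proof (H s t Hs Ht); pose proof (H t s Ht Hs); lra.
Qed.

(** * The curvature equation *)

(** The Hessian determinant of the function [f(y) g(z)]. *)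
Definition hessian (f g : R -> R) (y z : R) : R :=
  f y * Derive (Derive f) y * (g z * Derive (Derive g) z)
  - Derive f y ^ 2 * Derive g z ^ 2.

(** The quantity under the absolute value in [W^2]; its sign is the causal
    character [eps] of the surface. *)
Definition causal (f g : R -> R) (y z : R) : R :=
  (f y * Derive g z) ^ 2 - (Derive f y * g z) ^ 2.

Lemma pd_x (f g : R -> R) (i : index) (y z : R) :
  pd i (cx (factorable2 f g)) y z =
  match i with i1 => Derive f y * g z | i2 => f y * Derive g z end.
Proof.
destruct i; simpl; [apply Derive_scal_l | apply Derive_scal].
Qed.

Lemma pd_y (f g : R -> R) (i : index) (y z : R) :
  pd i (cy (factorable2 f g)) y z = match i with i1 => 1 | i2 => 0 end.
Proof. destruct i; simpl; [apply Derive_id | apply Derive_const]. Qed.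

Lemma pd_z (f g : R -> R) (i : index) (y z : R) :
  pd i (cz (factorable2 f g)) y z = match i with i1 => 0 | i2 => 1 end.
Proof. destruct i; simpl; [apply Derive_const | apply Derive_id]. Qed.

Lemma pd_ext (i : index) (h k : R -> R -> R) (y z : R) :
  (forall s t, h s t = k s t) -> pd i h y z = pd i k y z.
Proof. intros E; destruct i; simpl; apply Derive_ext; intros; apply E. Qed.

Lemma pd2_x (f g : R -> R) (i j : index) (y z : R) :
  pd2 i j (cx (factorable2 f g)) y z =
  match i, j with
  | i1, i1 => Derive (Derive f) y * g z
  | i2, i2 => f y * Derive (Derive g) z
  | _, _ => Derive f y * Derive g z
  end.
Proof.
unfold pd2; rewrite (pd_ext _ _ _ y z (pd_x f g i)).
destruct i, j; simpl; solve [apply Derive_scal_l | apply Derive_scal].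
Qed.

Lemma pd2_y (f g : R -> R) (i j : index) (y z : R) :
  pd2 i j (cy (factorable2 f g)) y z = 0.
Proof.
unfold pd2; rewrite (pd_ext _ _ _ y z (pd_y f g i)).
destruct j; simpl; apply Derive_const.
Qed.

Lemma pd2_z (f g : R -> R) (i j : index) (y z : R) :
  pd2 i j (cz (factorable2 f g)) y z = 0.
Proof.
unfold pd2; rewrite (pd_ext _ _ _ y z (pd_z f g i)).
destruct j; simpl; apply Derive_const.
Qed.

Lemma minors_factorable2 (f g : R -> R) (y z : R) :
  minor_xy (factorable2 f g) y z = - (f y * Derive g z) /\
  minor_xz (factorable2 f g) y z = Derive f y * g z.
Proof. unfold minor_xy, minor_xz; rewrite !pd_x, !pd_y, !pd_z; lra. Qed.

Lemma W_sqr_factorable2 (f g : R -> R) (y z : R) :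
  W (factorable2 f g) y z ^ 2 = Rabs (causal f g y z).
Proof.
destruct (minors_factorable2 f g y z) as [E1 E2].
unfold W, causal; rewrite pow2_sqrt; [| apply Rabs_pos].
rewrite E1, E2; f_equal; ring.
Qed.

Lemma eps_factorable2 (f g : R -> R) (y z : R) :
  W (factorable2 f g) y z <> 0 ->
  eps (factorable2 f g) y z * W (factorable2 f g) y z ^ 2 = causal f g y z.
Proof.
destruct (minors_factorable2 f g y z) as [E1 E2].
intros HW; unfold eps, side_tangent, mdot, causal, scal; simpl.
unfold scal; simpl; unfold mult; simpl; rewrite E1, E2.
field; exact HW.
Qed.

(** The two candidate formulas for [L_ij] agree; the case distinction in its
    definition only serves to avoid a zero denominator. *)
Lemma L_factorable2 (f g : R -> R) (i j : index) (y z : R) :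
  W (factorable2 f g) y z <> 0 ->
  L (factorable2 f g) i j y z =
  - eps (factorable2 f g) y z * pd2 i j (cx (factorable2 f g)) y z
  / W (factorable2 f g) y z.
Proof.
intros HW.
assert (Hxy : gi (factorable2 f g) i1 y z = 0 ->
              gi (factorable2 f g) i2 y z <> 0).
{ intros H1 H2; apply HW; unfold gi in H1, H2; rewrite pd_x in H1, H2.
  pose proof (W_sqr_factorable2 f g y z) as E.
  unfold causal in E; rewrite H1, H2 in E.
  replace (0 ^ 2 - 0 ^ 2) with 0 in E by ring; rewrite Rabs_R0 in E.
  now apply (Rsqr_0_uniq _); unfold Rsqr; rewrite <- E; ring. }
destruct (minors_factorable2 f g y z) as [E1 E2].
unfold L; destruct (Req_EM_T _ _) as [H | H];
  [specialize (Hxy H); clear H; rename Hxy into H |];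
  unfold L_via, normal;
  change (gij (factorable2 f g) i j y z)
    with (pd2 i j (cx (factorable2 f g)) y z);
  rewrite E1, E2, pd2_y, pd2_z, pd_y, pd_z;
  unfold gi in *; rewrite pd_x in H |- *;
  generalize dependent (W (factorable2 f g) y z);
  generalize (eps (factorable2 f g) y z);
  generalize (pd2 i j (cx (factorable2 f g)) y z); intros p e w Hw;
  unfold mdot, minus, plus, opp, scal; simpl;
  unfold plus, opp, scal; simpl; unfold mult; simpl;
  (field; split; [exact Hw | split; intros E; apply H; rewrite E; ring]).
Qed.

Lemma eps_sqr (f g : R -> R) (y z : R) :
  W (factorable2 f g) y z <> 0 -> eps (factorable2 f g) y z ^ 2 = 1.
Proof.
intros HW.
pose proof (pow2_abs (causal f g y z)) as E.
rewrite <- (W_sqr_factorable2 f g), <- (eps_factorable2 f g y z HW) in E.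
apply Rmult_eq_reg_r with ((W (factorable2 f g) y z ^ 2) ^ 2).
- rewrite <- Rpow_mult_distr, <- E; ring.
- now apply pow_nonzero, pow_nonzero.
Qed.

(** As [eps^2 = 1], the definitions give [hessian = - K eps W^4].  The factor
    [eps W^4] is kept in the form [|D| D], because the sign of [D] is only later
    seen not to depend on the point. *)
Lemma curvature_equation (f g : R -> R) (y z : R) :
  W (factorable2 f g) y z <> 0 ->
  causal f g y z <> 0 /\
  hessian f g y z =
  - gauss_curvature (factorable2 f g) y z
  * Rabs (causal f g y z) * causal f g y z.
Proof.
intros HW; pose proof (eps_sqr f g y z HW) as He.
rewrite <- (W_sqr_factorable2 f g), <- (eps_factorable2 f g y z HW).
split.
- apply Rmult_integral_contrapositive_currified.
  + intros E; rewrite E in He; lra.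
  + now apply pow_nonzero.
- unfold gauss_curvature; rewrite !(L_factorable2 f g) by exact HW.
  rewrite !pd2_x.
  set (w := W _ _ _) in *; set (e := eps _ _ _) in *.
  transitivity ((e ^ 2) ^ 2 * hessian f g y z).
  + rewrite He; ring.
  + unfold hessian; field; exact HW.
Qed.

(** What remains of constant curvature: a Monge-Ampere equation, together with
    the non-degeneracy that makes it meaningful. *)
Definition monge_equation (C : R) (a b c d : Rbar) (f g : R -> R) : Prop :=
  forall y z, in_open a b y -> in_open c d z ->
    causal f g y z <> 0 /\ hessian f g y z = C * causal f g y z ^ 2.

Lemma causal_swap (f g : R -> R) (y z : R) :
  causal g f z y = - causal f g y z.
Proof. unfold causal; ring. Qed.

Lemma monge_equation_swap (C : R) (a b c d : Rbar) (f g : R -> R) :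
  monge_equation C a b c d f g -> monge_equation C c d a b g f.
Proof.
intros H z y Hz Hy; destruct (H y z Hy Hz) as [H1 H2].
rewrite causal_swap; split; [lra |].
transitivity (hessian f g y z); [unfold hessian; ring |].
rewrite H2; ring.
Qed.

Lemma ex_derive_causal (a b : Rbar) (f g : R -> R) (z y : R) :
  smooth_on a b f -> in_open a b y -> ex_derive (fun t => causal f g t z) y.
Proof.
intros Hf Hy; unfold causal.
pose proof (Hf 1%nat y Hy) as D1; pose proof (Hf 2%nat y Hy) as D2.
simpl in D1, D2; auto_derive; auto.
Qed.

(** From [(y0, z0)] to [(y, z)] along the two sides through [(y, z0)]: this
    needs only the intermediate value theorem in one variable. *)
Lemma causal_sign_constant (a b c d : Rbar) (f g : R -> R) (y0 z0 y z : R) :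
  smooth_on a b f -> smooth_on c d g ->
  (forall y z, in_open a b y -> in_open c d z -> causal f g y z <> 0) ->
  in_open a b y0 -> in_open c d z0 -> in_open a b y -> in_open c d z ->
  0 < causal f g y0 z0 -> 0 < causal f g y z.
Proof.
intros Hf Hg Hn Hy0 Hz0 Hy Hz H0.
assert (H1 : 0 < causal f g y z0).
{ apply (nonvanishing_same_sign a b (fun t => causal f g t z0) y0 y); auto.
  intros u Hu; now apply ex_derive_causal with a b. }
apply (nonvanishing_same_sign c d (fun t => causal f g y t) z0 z); auto.
intros u Hu; apply ex_derive_ext with (fun t => - causal g f t y).
- intros t; unfold causal; ring_simplify; reflexivity.
- apply (ex_derive_opp (V := R_NormedModule)).
  now apply ex_derive_causal with c d.
Qed.

Lemma constant_curvature_monge (a b c d : Rbar) (f g : R -> R) (K : R) :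
  Rbar_lt a b -> Rbar_lt c d -> smooth_on a b f -> smooth_on c d g ->
  non_lightlike (rect a b c d) (factorable2 f g) ->
  (forall y z, rect a b c d y z ->
    gauss_curvature (factorable2 f g) y z = K) ->
  monge_equation (- K) a b c d f g \/ monge_equation K a b c d f g.
Proof.
intros Hab Hcd Hf Hg HW HK.
assert (H : forall y z, in_open a b y -> in_open c d z ->
  causal f g y z <> 0 /\
  hessian f g y z = - K * Rabs (causal f g y z) * causal f g y z).
{ intros y z Hy Hz; rewrite <- (HK y z (conj Hy Hz)).
  apply curvature_equation, HW; now split. }
destruct (classic (exists y z, in_open a b y /\ in_open c d z /\
  0 < causal f g y z)) as [[y0 [z0 [Hy0 [Hz0 P]]]] | N]; [left | right];
  intros y z Hy Hz; destruct (H y z Hy Hz) as [H1 H2];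
  split; trivial; rewrite H2.
- rewrite Rabs_pos_eq; [ring |].
  left; apply (causal_sign_constant a b c d f g y0 z0 y z); auto.
  intros u v Hu Hv; exact (proj1 (H u v Hu Hv)).
- rewrite Rabs_left; [ring |].
  destruct (Rtotal_order (causal f g y z) 0) as [Q | [Q | Q]]; auto.
  + contradiction.
  + exfalso; apply N; now exists y, z.
Qed.

(** * Separation of variables *)

Definition det3 (m : R -> R -> R) (y1 y2 y3 z1 z2 z3 : R) : R :=
  m y1 z1 * (m y2 z2 * m y3 z3 - m y2 z3 * m y3 z2)
  - m y1 z2 * (m y2 z1 * m y3 z3 - m y2 z3 * m y3 z1)
  + m y1 z3 * (m y2 z1 * m y3 z2 - m y2 z2 * m y3 z1).

Lemma det3_rank_two (p q u v : R -> R) (y1 y2 y3 z1 z2 z3 : R) :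
  det3 (fun y z => p y * q z - u y * v z) y1 y2 y3 z1 z2 z3 = 0.
Proof. unfold det3; ring. Qed.

(** [(Q - P)^2 = Q^2 - 2 P Q + P^2] factors the matrix of the
    [(Q z_j - P y_i)^2] through the monomials [1, P, P^2] and [Q^2, - 2 Q, 1]:
    two Vandermonde matrices, up to a factor 2 and a reversal. *)
Lemma det3_squared_differences (s t P Q : R -> R) (C : R)
    (y1 y2 y3 z1 z2 z3 : R) :
  det3 (fun y z => C * (s y * t z * (Q z - P y)) ^ 2) y1 y2 y3 z1 z2 z3 =
  2 * C ^ 3 * (s y1 * s y2 * s y3 * (t z1 * t z2 * t z3)) ^ 2
  * ((P y2 - P y1) * (P y3 - P y1) * (P y3 - P y2))
  * ((Q z2 - Q z1) * (Q z3 - Q z1) * (Q z3 - Q z2)).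
Proof. unfold det3; ring. Qed.

Definition log_slope_sqr (f : R -> R) (y : R) : R := (Derive f y / f y) ^ 2.

(** A separated expression with two terms has rank at most 2, whereas three
    distinct values on both sides would give rank 3. *)
Lemma monge_at_most_two_values (C : R) (a b c d : Rbar) (f g : R -> R) :
  C <> 0 -> monge_equation C a b c d f g ->
  (forall y, in_open a b y -> f y <> 0) ->
  (forall z, in_open c d z -> g z <> 0) ->
  takes_at_most_two_values a b (log_slope_sqr f) \/
  takes_at_most_two_values c d (log_slope_sqr g).
Proof.
intros HC HE Nf Ng.
destruct (classic (takes_at_most_two_values a b (log_slope_sqr f))) as [H | H];
  [now left | right].
intros z1 z2 z3 Hz1 Hz2 Hz3.
apply NNPP; intros N; apply H; intros y1 y2 y3 Hy1 Hy2 Hy3.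
apply NNPP; intros M.
assert (E : forall y z, in_open a b y -> in_open c d z ->
  C * (f y ^ 2 * g z ^ 2 * (log_slope_sqr g z - log_slope_sqr f y)) ^ 2 =
  f y * Derive (Derive f) y * (g z * Derive (Derive g) z)
  - Derive f y ^ 2 * Derive g z ^ 2).
{ intros y z Hy Hz; destruct (HE y z Hy Hz) as [_ H2].
  unfold hessian in H2; rewrite H2; unfold causal, log_slope_sqr.
  field; split; auto. }
pose proof (det3_squared_differences (fun y => f y ^ 2) (fun z => g z ^ 2)
  (log_slope_sqr f) (log_slope_sqr g) C y1 y2 y3 z1 z2 z3) as V.
pose proof (det3_rank_two (fun y => f y * Derive (Derive f) y)
  (fun z => g z * Derive (Derive g) z)
  (fun y => Derive f y ^ 2) (fun z => Derive g z ^ 2) y1 y2 y3 z1 z2 z3) as Z.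
(* The equation identifies the two determinants, entry by entry. *)
unfold det3 in V, Z; rewrite !E in V by assumption; rewrite Z in V.
symmetry in V; revert V.
repeat apply Rmult_integral_contrapositive_currified;
  try apply pow_nonzero;
  repeat apply Rmult_integral_contrapositive_currified;
  try apply pow_nonzero; auto; try lra;
  intros E0; (apply M || apply N); lra.
Qed.

Lemma ex_derive_log_slope_sqr (a b : Rbar) (f : R -> R) (y : R) :
  smooth_on a b f -> in_open a b y -> f y <> 0 ->
  ex_derive (log_slope_sqr f) y.
Proof.
intros Hf Hy Nf; unfold log_slope_sqr.
pose proof (Hf 1%nat y Hy) as D1; pose proof (Hf 2%nat y Hy) as D2.
simpl in D1, D2; auto_derive; auto.
Qed.

(** Differentiating [f'^2 = k f^2] gives [f'' = k f] wherever [f' <> 0], which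
    is everywhere unless [k = 0]; these [f] are the exponentials and the
    constants, so [log f] is affine. *)
Lemma proportional_slope_second_derivative (a b : Rbar) (f : R -> R) (k : R) :
  smooth_on a b f -> (forall y, in_open a b y -> f y <> 0) ->
  (forall y, in_open a b y -> Derive f y ^ 2 = k * f y ^ 2) ->
  forall y, in_open a b y -> f y * Derive (Derive f) y = Derive f y ^ 2.
Proof.
intros Hf Nf Ek y Hy.
pose proof (smooth_on_is_derive a b f y Hf Hy) as D1.
pose proof (smooth_on_is_derive2 a b f y Hf Hy) as D2.
destruct (Req_dec (Derive f y) 0) as [Z | Z].
- destruct (Req_dec k 0) as [Zk | Zk].
  + assert (E0 : Derive (Derive f) y = 0).
    { apply (is_derive_unique_on a b (Derive f) (fun _ => 0) y); auto.
      - intros s Hs; pose proof (Ek s Hs) as E; rewrite Zk in E.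
        apply Rsqr_0_uniq; unfold Rsqr; lra.
      - apply (is_derive_const (K := R_AbsRing) (V := R_NormedModule)). }
    rewrite E0, Z; ring.
  + exfalso; pose proof (Ek y Hy) as E; rewrite Z in E.
    apply (Rmult_integral_contrapositive_currified k (f y ^ 2)); auto.
    * apply pow_nonzero; auto.
    * lra.
- assert (E : 2 * Derive f y * Derive (Derive f) y =
              k * (2 * f y * Derive f y)).
  { apply (is_derive_unique_on a b (fun t => Derive f t ^ 2)
             (fun t => k * f t ^ 2) y); auto.
    - now apply is_derive_sqr.
    - now apply is_derive_scal, is_derive_sqr. }
  rewrite Ek by exact Hy.
  apply Rmult_eq_reg_l with (2 * Derive f y); [| lra].
  transitivity (f y * (2 * Derive f y * Derive (Derive f) y)); [ring |].
  rewrite E; ring.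
Qed.

(** With [f'^2 = k f^2] and [f f'' = f'^2] the equation at a fixed [z] reads
    [k f^2 (g g'' - g'^2) = C f^4 (g'^2 - k g^2)^2], where the last factor does
    not vanish.  It determines [f^2] from [z] alone, so [f] is constant and
    [k = 0], and the left-hand side vanishes while the right-hand side does not. *)
Lemma no_constant_log_slope_sqr (C : R) (a b c d : Rbar) (f g : R -> R) :
  Rbar_lt a b -> Rbar_lt c d -> C <> 0 -> smooth_on a b f ->
  monge_equation C a b c d f g ->
  (forall y, in_open a b y -> f y <> 0) ->
  ~ takes_at_most_two_values a b (log_slope_sqr f).
Proof.
intros Hab Hcd HC Hf HE Nf H2.
destruct (in_open_inhabited a b Hab) as [y0 Hy0].
destruct (in_open_inhabited c d Hcd) as [z Hz].
set (k := log_slope_sqr f y0).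
assert (Ek : forall y, in_open a b y -> Derive f y ^ 2 = k * f y ^ 2).
{ intros y Hy; unfold k.
  rewrite (at_most_two_values_constant a b (log_slope_sqr f))
    with (t := y); auto.
  - unfold log_slope_sqr; field; auto.
  - intros u Hu; apply ex_derive_log_slope_sqr with a b; auto. }
pose proof (proportional_slope_second_derivative a b f k Hf Nf Ek) as Eff.
set (q := Derive g z ^ 2); set (t := g z ^ 2).
set (B := g z * Derive (Derive g) z).
assert (Nqt : q - k * t <> 0).
{ intros E; destruct (HE y0 z Hy0 Hz) as [H _]; apply H; unfold causal.
  rewrite !Rpow_mult_distr, Ek by exact Hy0; fold q t.
  transitivity (f y0 ^ 2 * (q - k * t)); [ring | rewrite E; ring]. }
assert (Ef : forall y, in_open a b y ->
  f y ^ 2 = k * (B - q) / (C * (q - k * t) ^ 2)).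
{ intros y Hy; destruct (HE y z Hy Hz) as [_ H].
  unfold hessian, causal in H.
  rewrite !Rpow_mult_distr, Eff, !Ek in H by exact Hy.
  fold B q t in H.
  apply Rmult_eq_reg_l with (f y ^ 2 * (C * (q - k * t) ^ 2)).
  - transitivity (C * (f y ^ 2 * q - k * f y ^ 2 * t) ^ 2); [ring |].
    rewrite <- H; field; auto.
  - repeat apply Rmult_integral_contrapositive_currified;
      try apply pow_nonzero; auto. }
assert (Zf : Derive f y0 = 0).
{ assert (E : 2 * f y0 * Derive f y0 = 0).
  { apply (is_derive_unique_on a b (fun s => f s ^ 2)
             (fun _ => k * (B - q) / (C * (q - k * t) ^ 2)) y0); auto.
    - now apply is_derive_sqr, smooth_on_is_derive with a b.
    - apply (is_derive_const (K := R_AbsRing) (V := R_NormedModule)). }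
  apply Rmult_eq_reg_l with (2 * f y0); [lra |].
  pose proof (Nf y0 Hy0); lra. }
assert (Zk : k = 0).
{ unfold k, log_slope_sqr; rewrite Zf; field; auto. }
apply (pow_nonzero (f y0) 2); auto.
rewrite (Ef y0 Hy0).
replace (k * (B - q)) with 0 by (rewrite Zk; ring); unfold Rdiv; ring.
Qed.

(** If [f] vanished identically then so would [f'] and hence [D]. *)
Lemma monge_nonvanishing_subinterval (C : R) (a b c d : Rbar) (f g : R -> R) :
  Rbar_lt a b -> Rbar_lt c d -> smooth_on a b f ->
  monge_equation C a b c d f g ->
  exists a' b' : Rbar, Rbar_lt a' b' /\
    forall y, in_open a' b' y -> in_open a b y /\ f y <> 0.
Proof.
intros Hab Hcd Hf HE.
destruct (in_open_inhabited a b Hab) as [y Hy].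
destruct (in_open_inhabited c d Hcd) as [z Hz].
assert (H0 : exists y0, in_open a b y0 /\ f y0 <> 0).
{ apply NNPP; intros N.
  assert (Z : forall s, in_open a b s -> f s = 0).
  { intros s Hs; apply NNPP; intros Ns; apply N; now exists s. }
  assert (Z' : Derive f y = 0).
  { apply (is_derive_unique_on a b f (fun _ => 0) y); auto.
    - now apply smooth_on_is_derive with a b.
    - apply (is_derive_const (K := R_AbsRing) (V := R_NormedModule)). }
  destruct (HE y z Hy Hz) as [H _]; apply H.
  unfold causal; rewrite Z', (Z y Hy); ring. }
destruct H0 as [y0 [Hy0 N0]].
assert (Hc : continuous f y0).
{ apply (ex_derive_continuous (V := R_NormedModule)).
  exact (Hf 1%nat y0 Hy0). }
assert (L0 : locally y0 (fun s => in_open a b s /\ f s <> 0)).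
{ apply filter_and; [now apply in_open_locally |].
  apply (Hc (fun v => v <> 0)), open_neq; exact N0. }
destruct L0 as [e He].
exists (Finite (y0 - e)), (Finite (y0 + e)); split.
- simpl; pose proof (cond_pos e); lra.
- intros s [H1 H2]; simpl in H1, H2; apply He.
  change (Rabs (s - y0) < e); apply Rabs_def1; lra.
Qed.

Lemma no_monge_solution (C : R) (a b c d : Rbar) (f g : R -> R) :
  Rbar_lt a b -> Rbar_lt c d -> smooth_on a b f -> smooth_on c d g ->
  C <> 0 -> ~ monge_equation C a b c d f g.
Proof.
intros Hab Hcd Hf Hg HC HE.
destruct (monge_nonvanishing_subinterval C a b c d f g)
  as [a' [b' [Hab' I]]]; auto.
pose proof (monge_equation_swap _ _ _ _ _ _ _ HE) as HE'.
destruct (monge_nonvanishing_subinterval C c d a b g f)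
  as [c' [d' [Hcd' J]]]; auto.
assert (Hf' : smooth_on a' b' f) by (intros n t Ht; apply Hf, I, Ht).
assert (Hg' : smooth_on c' d' g) by (intros n t Ht; apply Hg, J, Ht).
assert (HE1 : monge_equation C a' b' c' d' f g).
{ intros y z Hy Hz; apply HE; [apply I, Hy | apply J, Hz]. }
destruct (monge_at_most_two_values C a' b' c' d' f g) as [H | H]; auto.
- intros y Hy; apply I, Hy.
- intros z Hz; apply J, Hz.
- revert H; apply (no_constant_log_slope_sqr C a' b' c' d' f g); auto.
  intros y Hy; apply I, Hy.
- revert H; apply (no_constant_log_slope_sqr C c' d' a' b' g f); auto.
  + now apply monge_equation_swap.
  + intros z Hz; apply J, Hz.
Qed.

Theorem theorem4p1 :
  ~ exists (a b c d : Rbar) (f g : R -> R),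
      Rbar_lt a b /\ Rbar_lt c d /\
      smooth_on a b f /\ smooth_on c d g /\
      admissible (rect a b c d) (factorable2 f g) /\
      non_lightlike (rect a b c d) (factorable2 f g) /\
      exists K0 : R, K0 <> 0 /\
        forall y z : R, rect a b c d y z ->
          gauss_curvature (factorable2 f g) y z = K0.
Proof.
intros (a & b & c & d & f & g & Hab & Hcd & Hf & Hg & _ & HW & K0 & HK0 & HK).
destruct (constant_curvature_monge a b c d f g K0) as [H | H]; auto;
  revert H; apply no_monge_solution; auto; lra.
Qed.
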